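(* Let $P\subseteq M_{\mathbb R}$ be a $d$-dimensional reflexive polytope. Define $\alpha:=\max\{|\mathcal V(F)|: F\in\mathcal F(P)\}$ and $\beta:=\max\{|\mathcal F(F)|: F\in\mathcal F(P)\}$. 1. $|\mathcal V(P)|\le 2d\alpha$. More precisely: - if $\alpha\ge 2d-3$, then $|\mathcal V(P)|\le 2d(\alpha-d+2)-2$; - if $\alpha\le 2d-3$, then $|\mathcal V(P)|\le d\alpha+\alpha-d+1$. If $P$ is simplicial (i.e. $\alpha=d$) and $d\ge 3$, this yields $|\mathcal V(P)|\le d^2+1$. 2. $|\mathcal V(P)|\le(\alpha-d+1)\beta+2+2\sqrt{(\alpha-1)(d+1)\big((\alpha-1)+(\alpha-d+1)\beta\big)}$. If $P$ is simplicial (i.e. $\alpha=d=\beta$), this yields $|\mathcal V(P)|\le d+2+2\sqrt{(d^2-1)(2d-1)}$.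
   Context: Let $M\cong\mathbb Z^d$ be a lattice with dual lattice $N$. A reflexive polytope is a $d$-dimensional lattice polytope $P\subseteq M_{\mathbb R}$ (vertices in $M$) with $0\in\mathrm{int}\,P$ whose dual $P^*=\{y\in N_{\mathbb R}:\langle x,y\rangle\ge -1\ \forall x\in P\}$ is a lattice polytope. For a polytope $Q$, $\mathcal V(Q)$ is its set of vertices and $\mathcal F(Q)$ its set of facets; in particular, for a facet $F$ of $P$, $\mathcal F(F)$ is the set of $(d-2)$-dimensional faces of $F$. $P$ is simplicial if every facet is a simplex. *)

(* Defs.v *)
From mathcomp Require Export all_boot all_order all_algebra finmap.
From mathcomp Require Export boolp classical_sets cardinality reals topology.
From mathcomp Require Export normedtype.
Export Order.TTheory GRing.Theory Num.Theory numFieldNormedType.Exports.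

Set Implicit Arguments.
Unset Strict Implicit.
Unset Printing Implicit Defensive.

Local Open Scope classical_set_scope.
Local Open Scope ring_scope.

(* A basis of the lattice M, together with the dual basis of N, identifies
   M and N with Z^d, both M_R and N_R with R^d, and the pairing
   M_R x N_R -> R with the standard one. *)
Definition pairing (R : realType) (d : nat) (x y : 'rV[R]_d) : R :=
  (x *m y^T) 0 0.

Definition lattice_points (R : realType) (d : nat) : set 'rV[R]_d :=
  [set x | x \is a mxOver Num.int].

(* For infinite A this is the junk value 0; here it is only applied to the
   sets of vertices and of facets of a polytope, which are finite. *)
Definition ncard (T : choiceType) (A : set T) : nat := #|` fset_set A|.

Definition conv (R : realType) (d : nat) (s : seq 'rV[R]_d) : set 'rV[R]_d :=
  [set x | exists w : 'I_(size s) -> R,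
    [/\ forall i, 0 <= w i, \sum_i w i = 1 & x = \sum_i w i *: s`_i]].

Definition polytope (R : realType) (d : nat) (Q : set 'rV[R]_d) : Prop :=
  exists s : seq 'rV[R]_d, Q = conv s.

(* Affine independence of points is linear independence of the vectors
   (1, x). *)
Definition aff_free (R : realType) (d : nat) (s : seq 'rV[R]_d) : bool :=
  free [seq row_mx (1%:M : 'M[R]_1) x | x <- s].

(* The dimension of the affine hull of A, as the largest number of affinely
   independent points of A minus one; in particular dim set0 = -1, so that
   set0 is a facet of a point. *)
Definition dim (R : realType) (d : nat) (A : set 'rV[R]_d) : int :=
  (\max_(k < d.+2 | `[< exists s : k.-tuple 'rV[R]_d,
                         aff_free s /\ forall x, x \in s -> A x >]) k)%:Z - 1.

(* Both Q itself and the empty set are faces of a polytope Q. *)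
Definition face (R : realType) (d : nat) (Q F : set 'rV[R]_d) : Prop :=
  exists (u : 'rV[R]_d) (c : R),
    (forall x, Q x -> c <= pairing x u) /\
    F = Q `&` [set x | pairing x u = c].

Definition vertices (R : realType) (d : nat) (Q : set 'rV[R]_d) :
    set 'rV[R]_d :=
  [set v | face Q [set v]].

Definition facets (R : realType) (d : nat) (Q : set 'rV[R]_d) :
    set (set 'rV[R]_d) :=
  [set F | face Q F /\ dim F = dim Q - 1].

Definition lattice_polytope (R : realType) (d : nat) (Q : set 'rV[R]_d) : Prop :=
  polytope Q /\ vertices Q `<=` @lattice_points R d.

Definition dual_polytope (R : realType) (d : nat) (Q : set 'rV[R]_d) : set 'rV[R]_d :=
  [set y | forall x, Q x -> -1 <= pairing x y].

Definition reflexive_polytope (R : realType) (d : nat) (P : set 'rV[R]_d) : Prop :=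
  [/\ lattice_polytope P, dim P = d%:Z, P° 0 & lattice_polytope (dual_polytope P)].

Definition simplex (R : realType) (d : nat) (Q : set 'rV[R]_d) : Prop :=
  exists s : seq 'rV[R]_d, aff_free s /\ Q = conv s.

Definition simplicial (R : realType) (d : nat) (P : set 'rV[R]_d) : Prop :=
  forall F, facets P F -> simplex F.

(* In the two maxima below, the set of facets is finite since P is a
   polytope. *)
Definition max_vertices (R : realType) (d : nat) (P : set 'rV[R]_d) : nat :=
  (\max_(F <- fset_set (facets P)) ncard (vertices F))%N.

Definition max_facets (R : realType) (d : nat) (P : set 'rV[R]_d) : nat :=
  (\max_(F <- fset_set (facets P)) ncard (facets F))%N.

(* Main.v *)
Require Import Defs.
From mathcomp Require Import zify ring lra.

Set Implicit Arguments.
Unset Strict Implicit.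
Unset Printing Implicit Defensive.

Local Open Scope classical_set_scope.
Local Open Scope ring_scope.

(** One inequality gives both parts.  Call [d] the dimension and [alpha] the
    largest number of vertices of a facet.  Every vertex [u] of the dual polytope
    defines a facet of [P], the set of the points [x] of [P] with [<x, u> = -1],
    and [<x, u>] is an integer [>= -1] for every vertex [x] of [P].  As [0] is a
    convex combination of the vertices of the dual, some [u] has a nonpositive
    pairing with the sum of all vertices of [P] ([special_vertex]).  For this
    [u]:
    - at most [alpha] vertices have height [<x, u> = -1];
    - since the heights sum to at most [0], at most as many vertices have
      positive height ([card_positive_le]);
    - a vertex of height [0] lies on a facet that meets the facet of [u] in a
      face of dimension [d - 2].  That face has at least [d - 1] vertices, so
      each such neighbouring facet contributes at most [alpha - d + 1] vertices.

    Hence [|V(P)| <= 2 alpha + k (alpha - d + 1)] as soon as [k] neighbouring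
    facets cover the vertices of height [0] ([card_vertices_bound]).

    A family of neighbours [w] covers as soon as the projections of the [w]
    along [u] generate the hyperplane orthogonal to [u] as a cone: then for a
    vertex [x] in this hyperplane, [- x] is a nonnegative combination of the
    projections, and some [w] must satisfy [<x, w> < 0], that is [<x, w> = -1].
    All neighbours together have this property, because the dual polytope spans
    from [u] the cone over its vertex figure, whose vertices correspond to edges
    at [u] ([nbrs_cone]).  There are at most [beta] of them ([card_nbrs_le]), which
    gives [k = beta]; and by the theorem of Steinitz at most [2 (d - 1)] of them
    suffice ([steinitz]), which gives [k = 2 (d - 1)].

    The second choice reads [|V(P)| <= 2 d (alpha - d + 2) - 2].  This is the
    bound for large [alpha], and it exceeds [d alpha + alpha - d + 1] by
    [(d - 1) (alpha - (2 d - 3))], so it implies the bound for small [alpha] too.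
    The first choice implies the bound with the square root, which is at least
    [alpha - 1].

    The convexity used is elementary: Farkas' lemma by induction on the number of
    generators, from which follow the separation of a point from a convex hull
    and the fact that a polytope is the convex hull of its vertices
    ([hull_verts]).  Points [x] are often replaced by [(1, x)]; affine relations
    and dimensions then become linear ones. *)

(** * The pairing and orthogonality *)

Section Pairing.
Variables (R : realType) (d : nat).
Implicit Types x y z : 'rV[R]_d.

Lemma pairingE x y : pairing x y = \sum_i x 0 i * y 0 i.
Proof. by rewrite /pairing mxE; apply: eq_bigr => i _; rewrite mxE. Qed.

Lemma pairingC x y : pairing x y = pairing y x.
Proof. by rewrite !pairingE; apply: eq_bigr => i _; rewrite mulrC. Qed.

Lemma pairingDl x y z : pairing (x + y) z = pairing x z + pairing y z.
Proof. by rewrite /pairing mulmxDl mxE. Qed.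

Lemma pairingZl a x y : pairing (a *: x) y = a * pairing x y.
Proof. by rewrite /pairing -scalemxAl mxE. Qed.

Lemma pairingDr x y z : pairing x (y + z) = pairing x y + pairing x z.
Proof. by rewrite pairingC pairingDl !(pairingC x). Qed.

Lemma pairingZr a x y : pairing x (a *: y) = a * pairing x y.
Proof. by rewrite pairingC pairingZl pairingC. Qed.

Lemma pairing0l y : pairing 0 y = 0.
Proof. by rewrite -(scale0r (0 : 'rV[R]_d)) pairingZl mul0r. Qed.

Lemma pairing0r x : pairing x 0 = 0.
Proof. by rewrite pairingC pairing0l. Qed.

Lemma pairingNl x y : pairing (- x) y = - pairing x y.
Proof. by rewrite -scaleN1r pairingZl mulN1r. Qed.

Lemma pairingNr x y : pairing x (- y) = - pairing x y.
Proof. by rewrite pairingC pairingNl pairingC. Qed.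

Lemma pairingBl x y z : pairing (x - y) z = pairing x z - pairing y z.
Proof. by rewrite pairingDl pairingNl. Qed.

Lemma pairingBr x y z : pairing x (y - z) = pairing x y - pairing x z.
Proof. by rewrite pairingDr pairingNr. Qed.

Lemma pairing_suml (I : Type) (r : seq I) (F : I -> 'rV[R]_d) y :
  pairing (\sum_(i <- r) F i) y = \sum_(i <- r) pairing (F i) y.
Proof.
elim: r => [|i r IH]; first by rewrite !big_nil pairing0l.
by rewrite !big_cons pairingDl IH.
Qed.

Lemma pairing_sumr (I : Type) (r : seq I) x (F : I -> 'rV[R]_d) :
  pairing x (\sum_(i <- r) F i) = \sum_(i <- r) pairing x (F i).
Proof.
by rewrite pairingC pairing_suml; apply: eq_bigr => i _; rewrite pairingC.
Qed.

Lemma pairing_self_ge0 x : 0 <= pairing x x.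
Proof. by rewrite pairingE; apply: sumr_ge0 => i _; rewrite -expr2 sqr_ge0. Qed.

Lemma pairing_self_eq0 x : (pairing x x == 0) = (x == 0).
Proof.
apply/eqP/eqP => [|->]; last exact: pairing0l.
rewrite pairingE => /eqP; rewrite psumr_eq0; last first.
  by move=> i _; rewrite -expr2 sqr_ge0.
move=> /allP x0; apply/rowP => i; rewrite mxE.
by apply/eqP; rewrite -sqrf_eq0 expr2; apply: (x0 i); rewrite mem_index_enum.
Qed.

End Pairing.

Section Orthogonality.
Variables (R : realType) (d : nat).
Implicit Types (s t : seq 'rV[R]_d).

Lemma span_orth s x z :
  (forall v, v \in s -> pairing v z = 0) -> x \in <<s>>%VS -> pairing x z = 0.
Proof.
move=> sz; elim: s sz x => [|a s IH] sz x.
  by rewrite span_nil memv0 => /eqP ->; rewrite pairing0l.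
rewrite span_cons => /memv_addP[y /vlineP[k ->] [y' ys ->]].
rewrite pairingDl pairingZl sz ?mem_head // mulr0 add0r.
by apply: IH => // v vs; rewrite sz // inE vs orbT.
Qed.

Lemma dim_rV (n : nat) : \dim {:'rV[R]_n} = n.
Proof. by rewrite dimvf dim_matrix; apply: mul1n. Qed.

(** A span meets its orthogonal complement only in [0], the pairing being
    positive definite. *)
Lemma orth_dim_le s t :
  (forall x y, x \in s -> y \in t -> pairing x y = 0) ->
  (\dim <<s>> + \dim <<t>> <= d)%N.
Proof.
move=> st; rewrite -dimv_disjoint_sum.
  by apply: leq_trans (dimvS (subvf _)) _; rewrite dim_rV.
apply/eqP; rewrite -subv0; apply/subvP => x /memv_capP[xs xt].
rewrite memv0 -pairing_self_eq0; apply/eqP; apply: span_orth xs => v vs.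
by rewrite pairingC; apply: span_orth xt => y yt; rewrite pairingC st.
Qed.

Lemma free_subseq (vT : vectType R) (s : seq vT) :
  exists t : seq vT, [/\ free t, {subset t <= s} & <<t>>%VS = <<s>>%VS].
Proof.
elim: s => [|a s [t [ft ts e]]]; first by exists [::]; rewrite nil_free.
have [at_|at_] := boolP (a \in <<t>>%VS).
  exists t; split=> //; first by move=> x /ts; rewrite inE orbC => ->.
  rewrite span_cons -e; apply/esym/addv_idPr.
  by rewrite -memvE.
exists (a :: t); split; first by rewrite free_cons at_.
  by move=> x; rewrite !inE => /orP[-> //|/ts ->]; rewrite orbT.
by rewrite !span_cons e.
Qed.

(** The equations [pairing v z = 0], [v] in a basis of [<<s>>], cut out a
    space of codimension at most the number of equations. *)
Lemma span_dim_ge s (K : {vspace 'rV[R]_d}) :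
  (forall z, (forall v, v \in s -> pairing v z = 0) -> z \in K) ->
  (d <= \dim <<s>> + \dim K)%N.
Proof.
move=> sK; have [t [ft ts e]] := free_subseq s.
pose M : 'M[R]_(d, size t) := (\matrix_(i, j) t`_i 0 j)^T.
pose f : 'Hom('rV[R]_d, 'rV[R]_(size t)) := linfun (mulmxr M).
have := limg_ker_dim f fullv; rewrite capfv dim_rV => dE.
rewrite -[X in (X <= _)%N]dE addnC leq_add //.
  apply: leq_trans (dimvS (subvf _)) _.
  by rewrite dim_rV -e; move: ft; rewrite /free => /eqP ->.
apply/dimvS/subvP => z; rewrite memv_ker lfunE /= => /eqP zM.
apply: sK => v vs; have vt : v \in <<t>>%VS by rewrite e memv_span.
apply: span_orth vt => w wt; move: (wt); rewrite -index_mem => it.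
move/rowP: zM => /(_ (Ordinal it)); rewrite !mxE => zw.
rewrite pairingC pairingE -[RHS]zw; apply: eq_bigr => i _.
by rewrite !mxE /= nth_index.
Qed.

End Orthogonality.

(** * Cones generated by finite families *)

Section Cone.
Variables (R : realType) (V : lmodType R).

Definition cone (I : eqType) (r : seq I) (F : I -> V) : set V :=
  [set z | exists2 c : I -> R, forall i, 0 <= c i & z = \sum_(i <- r) c i *: F i].

Variable (I : eqType).
Implicit Types (r : seq I) (F : I -> V).

Lemma cone0 r F : cone r F 0.
Proof. by exists (fun=> 0) => //; rewrite big1 // => i _; rewrite scale0r. Qed.

Lemma coneD r F x y : cone r F x -> cone r F y -> cone r F (x + y).
Proof.
move=> [c c0 ->] [e e0 ->]; exists (fun i => c i + e i).
  by move=> i; rewrite addr_ge0.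
by rewrite -big_split; apply: eq_bigr => i _; rewrite scalerDl.
Qed.

Lemma coneZ r F a x : 0 <= a -> cone r F x -> cone r F (a *: x).
Proof.
move=> a0 [c c0 ->]; exists (fun i => a * c i).
  by move=> i; rewrite mulr_ge0.
by rewrite scaler_sumr; apply: eq_bigr => i _; rewrite scalerA.
Qed.

Lemma cone_gen r F i : i \in r -> uniq r -> cone r F (F i).
Proof.
move=> ir ur; exists (fun j => (j == i)%:R); first by move=> j; rewrite ler0n.
rewrite (bigD1_seq i) //= eqxx scale1r big1 ?addr0 // => j /negbTE ->.
by rewrite scale0r.
Qed.

Lemma cone_sum (J : eqType) (s : seq J) r F (G : J -> V) :
  (forall j, j \in s -> cone r F (G j)) -> cone r F (\sum_(j <- s) G j).
Proof.
move=> h; rewrite big_seq; elim/big_ind: _ => //; first exact: cone0.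
by move=> x y; apply: coneD.
Qed.

Lemma cone_subset r s F :
  uniq r -> uniq s -> {subset r <= s} -> cone r F `<=` cone s F.
Proof.
move=> ur us rs z [c c0 ->]; apply: cone_sum => i ir.
by apply: coneZ => //; apply: cone_gen => //; apply: rs.
Qed.

End Cone.

Section Farkas.
Variables (R : realType) (d : nat) (I : eqType).

(** Induction on the number of generators.  A functional [p] that separates [z]
    from the tail but is negative on the new generator [a] is corrected by
    projecting along [a] onto the kernel of [p]: the projected generators and
    the projected [z] are again in the situation of the induction hypothesis,
    and a functional precomposed with that projection vanishes on [a]. *)
Lemma farkas (r : seq I) (F : I -> 'rV[R]_d) z : uniq r -> ~ cone r F z ->
  exists2 p, forall i, i \in r -> 0 <= pairing (F i) p & pairing z p < 0.
Proof.
elim: r F z => [|a r IH] F z /=.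
  move=> _ nz; exists (- z) => //; rewrite pairingNr oppr_lt0 lt_def.
  rewrite pairing_self_ge0 andbT pairing_self_eq0; apply: contra_notN nz => /eqP ->.
  exact: cone0.
move=> /andP[ar ur] nz.
have uar : uniq (a :: r) by rewrite /= ar.
have rar : {subset r <= a :: r} by move=> i ir; rewrite inE ir orbT.
have [|p pr pz] := IH F z ur.
  by move=> h; apply: nz; apply: cone_subset h.
have [pa|pa] := leP 0 (pairing (F a) p).
  by exists p => // i; rewrite inE => /predU1P[->|/pr].
pose k y := pairing y p / pairing (F a) p.
pose G i := F i - k (F i) *: F a.
have [|q qr qz] := IH G (z - k z *: F a) ur.
  move=> h; apply: nz.
  have -> : z = (z - k z *: F a) + k z *: F a by rewrite subrK.
  apply: coneD; last first.
    apply: coneZ; last by apply: cone_gen; rewrite ?mem_head.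
    by rewrite /k -mulrNN mulr_ge0 ?oppr_ge0 ?invr_le0 ?ltW.
  case: h => c c0 ->; apply: cone_sum => i ir; apply: coneZ => //.
  apply: coneD; first by apply: cone_gen => //; apply: rar.
  rewrite -scaleNr; apply: coneZ; last by apply: cone_gen; rewrite ?mem_head.
  by rewrite /k -mulrN mulr_ge0 ?pr // oppr_ge0 invr_le0 ltW.
have pq y : pairing y (q - (pairing (F a) q / pairing (F a) p) *: p) =
            pairing (y - k y *: F a) q.
  rewrite pairingBr pairingZr pairingBl pairingZl /k.
  by congr (_ - _); rewrite mulrAC [RHS]mulrAC [X in X / _]mulrC.
exists (q - (pairing (F a) q / pairing (F a) p) *: p); last by rewrite pq.
move=> i; rewrite inE => /predU1P[->|ir]; last by rewrite pq qr.
by rewrite pq /k divff ?lt_eqF // scale1r subrr pairing0l.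
Qed.

End Farkas.

Section Caratheodory.
Variables (R : realType) (vT : vectType R) (I : eqType).
Implicit Types (r : seq I) (F : I -> vT).

Lemma exists_argmin (T : eqType) (f : T -> R) (s : seq T) : s != [::] ->
  exists2 x, x \in s & forall y, y \in s -> f x <= f y.
Proof.
elim: s => [//|a s IH] _; have [->|s0] := eqVneq s [::].
  by exists a; rewrite ?mem_head // => y; rewrite inE => /eqP ->.
have [x xs xm] := IH s0; have [ax|/ltW xa] := leP (f a) (f x).
  exists a; rewrite ?mem_head // => y; rewrite inE => /predU1P[-> //|/xm].
  exact: le_trans ax.
exists x; first by rewrite inE xs orbT.
by move=> y; rewrite inE => /predU1P[->|/xm].
Qed.

Lemma span_mapP r F x : uniq r -> x \in <<map F r>>%VS ->
  exists c : I -> R, x = \sum_(i <- r) c i *: F i.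
Proof.
elim: r x => [|a r IH] x /=.
  by rewrite span_nil memv0 => _ /eqP ->; exists (fun=> 0); rewrite big_nil.
move=> /andP[ar ur]; rewrite span_cons.
move=> /memv_addP[y /vlineP[k ->] [y' /(IH _ ur)[c ->]] ->].
exists (fun i => if i == a then k else c i); rewrite big_cons eqxx; congr (_ + _).
by apply: eq_big_seq => i ir; case: eqP => // ia; rewrite -ia ir in ar.
Qed.

Lemma nonfree_relation r F : uniq r -> ~~ free (map F r) ->
  exists2 e : I -> R, exists2 i, i \in r & 0 < e i &
    \sum_(i <- r) e i *: F i = 0.
Proof.
elim: r => [|a r IH] /=; first by rewrite nil_free.
move=> /andP[ar ur]; rewrite free_cons negb_and negbK.
have ext (k : R) (c : I -> R) : \sum_(i <- a :: r) (if i == a then k else c i) *: F i =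
    k *: F a + \sum_(i <- r) c i *: F i.
  rewrite big_cons eqxx; congr (_ + _).
  by apply: eq_big_seq => i ir; case: eqP => // ia; rewrite -ia ir in ar.
have [/(span_mapP ur)[c ca]|_] := boolP (F a \in <<map F r>>%VS) => /=.
  move=> _; exists (fun i => if i == a then 1 else - c i).
    by exists a; rewrite ?mem_head // eqxx.
  rewrite ext scale1r ca -big_split big1 // => i _ /=.
  by rewrite scaleNr subrr.
move=> /(IH ur)[e [i ir ei] e0].
exists (fun i => if i == a then 0 else e i); last by rewrite ext scale0r add0r.
exists i; first by rewrite inE ir orbT.
by case: eqP => // ia; rewrite -ia ir in ar.
Qed.

(** Moving along a linear relation between the generators until the first
    coefficient vanishes removes a generator. *)
Lemma caratheodory r F z : uniq r -> cone r F z ->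
  exists t, [/\ uniq t, {subset t <= r}, free (map F t) & cone t F z].
Proof.
have [n] := ubnP (size r); elim: n r => // n IH r szr ur zr.
have [fr|/(nonfree_relation ur)[e [i0 i0r ei0] e0]] := boolP (free (map F r)).
  by exists r; split.
case: zr => c c0 zE.
have [|j] := @exists_argmin _ (fun i => c i / e i) [seq i <- r | 0 < e i].
  by rewrite -has_filter; apply/hasP; exists i0.
rewrite mem_filter => /andP[ej jr] jm.
have [||t [ut ts ft zt]] := IH (rem j r) _ (rem_uniq j ur).
- by rewrite size_rem //; case: (r) jr szr.
- exists (fun i => if i \in r then c i - c j / e j * e i else 0).
    move=> i; case: ifP => // ir; rewrite subr_ge0.
    have [ei|ei] := leP (e i) 0.
      apply: le_trans (c0 i); rewrite mulr_ge0_le0 // divr_ge0 //.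
      exact: ltW.
    by rewrite -ler_pdivlMr // jm // mem_filter ei.
  have -> : z = \sum_(i <- r) (c i - c j / e j * e i) *: F i.
    under eq_bigr do rewrite scalerBl -scalerA.
    by rewrite sumrB -scaler_sumr e0 scaler0 subr0.
  rewrite (perm_big _ (perm_to_rem jr)) big_cons /= divfK ?gt_eqF //.
  rewrite subrr scale0r add0r; apply: eq_big_seq => i.
  by rewrite mem_rem_uniq // inE => /andP[_ ->].
exists t; split=> // i /ts; exact: mem_rem.
Qed.

End Caratheodory.

Section Steinitz.
Variables (R : realType) (vT : vectType R) (I : eqType).

(** Let [B] index a basis among the generators, and [T] the at most [n]
    generators, [n] being the dimension, that suffice for [- sum of B].
    Adding a large multiple of
    [sum of B + (- sum of B) = 0] makes the coordinates of any vector in the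
    basis [B] nonnegative, so that [B] and [T] together generate. *)
Lemma steinitz (r : seq I) (F : I -> vT) : uniq r ->
  (forall z, z \in <<map F r>>%VS -> cone r F z) ->
  exists t, [/\ uniq t, {subset t <= r}, (size t <= 2 * \dim <<map F r>>)%N &
    forall z, z \in <<map F r>>%VS -> cone t F z].
Proof.
move=> ur gen.
have [B [uB Br fB sB]] : exists B, [/\ uniq B, {subset B <= r}, free (map F B) &
    <<map F B>>%VS = <<map F r>>%VS].
  elim: r {gen} ur => [|a r IH] /=; first by exists [::]; rewrite nil_free.
  move=> /andP[ar /IH[B [uB Br fB sB]]].
  have [aB|aB] := boolP (F a \in <<map F B>>%VS).
    exists B; split=> //; first by move=> x /Br; rewrite inE orbC => ->.
    by rewrite span_cons -sB; apply/esym/addv_idPr; rewrite -memvE.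
  exists (a :: B); split=> /=; rewrite ?free_cons ?aB //.
  - by rewrite uB andbT; apply: contraNN ar; apply: Br.
  - by move=> x; rewrite !inE => /orP[-> //|/Br ->]; rewrite orbT.
  - by rewrite !span_cons sB.
have mem_span j : j \in r -> F j \in <<map F r>>%VS.
  by move=> jr; rewrite memv_span // map_f.
pose b := - \sum_(i <- B) F i.
have bS : b \in <<map F r>>%VS.
  by rewrite memvN big_seq memv_suml // => i /Br /mem_span.
have [T [uT Tr fT bT]] := caratheodory ur (gen _ bS).
have size_free s : {subset s <= r} -> free (map F s) ->
    (size s <= \dim <<map F r>>)%N.
  move=> sr /eqP fs; rewrite -(size_map F) -fs dimvS //.
  by apply/span_subvP => _ /mapP[j /sr jr ->]; apply: mem_span.
exists (undup (B ++ T)); split; first exact: undup_uniq.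
- by move=> j; rewrite mem_undup mem_cat => /orP[/Br|/Tr].
- apply: leq_trans (size_undup _) _.
  by rewrite size_cat mul2n -addnn leq_add // size_free.
move=> z; rewrite -sB => /(span_mapP uB)[c ->].
set t := undup _; have ut : uniq t by exact: undup_uniq.
have Bt : {subset B <= t} by move=> j jB; rewrite mem_undup mem_cat jB.
have Tt : {subset T <= t} by move=> j jT; rewrite mem_undup mem_cat jT orbT.
pose M := \sum_(j <- B) `|c j|.
have -> : \sum_(i <- B) c i *: F i = \sum_(i <- B) (c i + M) *: F i + M *: b.
  rewrite scalerN scaler_sumr -sumrB; apply: eq_bigr => j _.
  by rewrite scalerDl addrK.
have M0 : 0 <= M by apply: sumr_ge0.
apply: coneD; last by apply: coneZ => //; apply: cone_subset bT.
apply: cone_sum => j jB; apply: coneZ; last by apply: cone_gen => //; apply: Bt.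
rewrite /M (bigD1_seq j) //= addrA -[X in X <= _]addr0 lerD //.
  by rewrite -(subrr (c j)) lerD2l ler_normr lexx orbT.
by apply: sumr_ge0.
Qed.

End Steinitz.

(** * Convex hulls of finite sets *)

Lemma cone_trans (R : realType) (V : lmodType R) (I J : eqType) (r : seq I)
    (F : I -> V) (s : seq J) (G : J -> V) :
  (forall i, i \in r -> cone s G (F i)) -> cone r F `<=` cone s G.
Proof. by move=> rs z [c c0 ->]; apply: cone_sum => i /rs; apply: coneZ. Qed.

Section Hull.
Variables (R : realType) (d : nat).
Local Notation V := 'rV[R]_d.
Implicit Types (A B : {fset V}) (F Q : set V) (x u v : V).

Definition homog (x : V) : 'rV[R]_(1 + d) := row_mx (1%:M : 'M[R]_1) x.

Lemma homogE x (p : 'rV[R]_(1 + d)) :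
  pairing (homog x) p = (lsubmx p) 0 0 + pairing x (rsubmx p).
Proof.
rewrite -{1}(hsubmxK p) /pairing tr_row_mx mul_row_col mxE mul1mx.
by rewrite [in X in X + _]mxE.
Qed.

Lemma homog_row x a y : pairing (homog x) (row_mx a%:M y) = a + pairing x y.
Proof. by rewrite homogE row_mxKl row_mxKr mxE mulr1n. Qed.

Lemma homog_neq0 x : homog x != 0.
Proof.
apply/eqP => /matrixP/(_ 0 (lshift d 0)); rewrite row_mxEl !mxE => /eqP.
by rewrite oner_eq0.
Qed.

(** Membership of [(1, x)] in a cone over points [(1, v)] encodes both that
    the weights add up to [1] and that [x] is the weighted sum. *)
Definition hull A : set V := [set x | cone A homog (homog x)].

Lemma homog_sum (I : Type) (r : seq I) (c : I -> R) (f : I -> V) x :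
  homog x = \sum_(i <- r) c i *: homog (f i) <->
  \sum_(i <- r) c i = 1 /\ x = \sum_(i <- r) c i *: f i.
Proof.
have -> : \sum_(i <- r) c i *: homog (f i) =
    row_mx (\sum_(i <- r) c i)%:M (\sum_(i <- r) c i *: f i).
  elim: r => [|i r IH]; first by rewrite !big_nil raddf0 row_mx0.
  by rewrite !big_cons IH scale_row_mx add_row_mx raddfD /= scale_scalar_mx mulr1.
split=> [/eq_row_mx[e ->]|[-> ->] //]; split=> //.
by move/matrixP: e => /(_ 0 0); rewrite !mxE !mulr1n.
Qed.

Lemma hullP A x : hull A x <-> exists c : V -> R,
  [/\ forall v, 0 <= c v, \sum_(v <- A) c v = 1 & x = \sum_(v <- A) c v *: v].
Proof.
split=> [[c c0 /homog_sum[c1 xE]]|[c [c0 c1 xE]]]; exists c => //.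
exact/homog_sum.
Qed.

Lemma hull_mem A v : v \in A -> hull A v.
Proof. by move=> vA; apply: cone_gen. Qed.

Lemma hull_sub A B : (forall v, v \in A -> hull B v) -> hull A `<=` hull B.
Proof. by move=> AB x; apply: cone_trans. Qed.

Lemma hullS A B : (A `<=` B)%fset -> hull A `<=` hull B.
Proof. by move=> /fsubsetP AB; apply: hull_sub => v /AB; apply: hull_mem. Qed.

Lemma hull_neq0 A x : hull A x -> A != fset0.
Proof.
move=> /hullP[c [_ c1 _]]; apply: contra_eq_neq c1 => ->.
by rewrite big_seq_fset0 eq_sym oner_eq0.
Qed.

Lemma conv_hull (s : seq V) : conv s = hull [fset x in s]%fset.
Proof.
have convE x : conv s x <->
    cone (index_enum 'I_(size s)) (fun i : 'I_(size s) => homog s`_i) (homog x).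
  split=> [[w [w0 w1 xE]]|[w w0 /homog_sum[w1 xE]]]; exists w => //.
  exact/homog_sum.
rewrite eqEsubset; split=> x.
  move/convE; apply: cone_trans => i _; apply: hull_mem.
  by rewrite !inE mem_nth.
move=> xA; apply/convE; apply: cone_trans xA => v; rewrite !inE => vs.
move: (vs); rewrite -index_mem => iv.
have -> : homog v = homog s`_(Ordinal iv) by rewrite nth_index.
exact: (@cone_gen _ _ _ _ (fun i : 'I_(size s) => homog s`_i))
  (mem_index_enum _) (index_enum_uniq _).
Qed.

Lemma polytope_hull Q : polytope Q -> exists A, Q = hull A.
Proof. by case=> s ->; exists [fset x in s]%fset; rewrite conv_hull. Qed.

Lemma hull_fset_conv A : hull A = conv (enum_fset A).
Proof. by rewrite conv_hull; congr hull; apply/fsetP => x; rewrite !inE. Qed.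

Lemma hull_ge A x u c : (forall v, v \in A -> c <= pairing v u) -> hull A x ->
  c <= pairing x u.
Proof.
move=> Ac /hullP[w [w0 w1 ->]]; rewrite pairing_suml -[c]mul1r -w1 mulr_suml.
rewrite big_seq [leRHS]big_seq; apply: ler_sum => v vA; rewrite pairingZl.
by rewrite ler_wpM2l ?Ac.
Qed.

Lemma hull_separation A x : ~ hull A x ->
  exists u, forall v, v \in A -> pairing x u < pairing v u.
Proof.
move=> /(farkas (fset_uniq A))[p Ap xp]; exists (rsubmx p) => v /Ap.
move: xp; rewrite !homogE => xp vp.
by rewrite -(ltrD2l (lsubmx p 0 0)) (lt_le_trans xp).
Qed.

(** * Faces and vertices of a hull *)

Lemma face_hull_eq A u c : (forall x, hull A x -> c <= pairing x u) ->
  hull A `&` [set x | pairing x u = c] =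
  hull [fset v in A | pairing v u == c]%fset.
Proof.
move=> Ac; rewrite eqEsubset; split=> x.
  move=> [/hullP[w [w0 w1 xE]] /= xu].
  have wz v : v \in A -> pairing v u != c -> w v = 0.
    move=> vA vc; have : \sum_(v <- A) w v * (pairing v u - c) == 0.
      under eq_bigr do rewrite mulrBr.
      rewrite sumrB -mulr_suml w1 mul1r -xu xE pairing_suml.
      by under [X in _ - X]eq_bigr do rewrite pairingZl; rewrite subrr.
    rewrite big_seq psumr_eq0 => [/allP/(_ v vA)|i iA].
      by rewrite [_ \in _]vA mulf_eq0 subr_eq0 (negbTE vc) orbF => /eqP.
    by rewrite mulr_ge0 // subr_ge0; apply: Ac; apply: hull_mem.
  have -> : hull [fset v in A | pairing v u == c]%fset x =
            cone [fset v in A | pairing v u == c]%fset homog (homog x) by [].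
  have -> : homog x = \sum_(v <- A) w v *: homog v by apply/homog_sum.
  apply: cone_sum => v vA; have [vc|/(wz _ vA) ->] := eqVneq (pairing v u) c.
    by apply: coneZ => //; apply: cone_gen; rewrite ?fset_uniq // !inE vA vc /=.
  by rewrite scale0r; apply: cone0.
move=> xB; split.
  by apply: hullS xB; apply/fsubsetP => v; rewrite !inE => /andP[].
move: xB => /hullP[w [w0 w1 ->]] /=; rewrite pairing_suml -[RHS]mul1r -w1 mulr_suml.
by apply: eq_big_seq => v; rewrite !inE pairingZl => /andP[_ /eqP ->].
Qed.

Lemma face_hull A F : face (hull A) F -> exists2 B, (B `<=` A)%fset & F = hull B.
Proof.
move=> [u [c [Ac ->]]]; exists [fset v in A | pairing v u == c]%fset.
  by apply/fsubsetP => v; rewrite !inE => /andP[].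
exact: face_hull_eq.
Qed.

Lemma vertices_hull_sub A v : vertices (hull A) v -> v \in A.
Proof.
move=> /face_hull[B /fsubsetP BA e].
have /hull_neq0/fset0Pn[b bB] : hull B v by rewrite -e.
by have : hull B b := hull_mem bB; rewrite -e => <-; apply: BA.
Qed.

Lemma finite_vertices A : finite_set (vertices (hull A)).
Proof.
apply: (@sub_finite_set _ _ [set` A]) => [v|]; last exact: finite_fset.
exact: vertices_hull_sub.
Qed.

Lemma finite_facets A : finite_set (facets (hull A)).
Proof.
apply: (@sub_finite_set _ _ (hull @` [set` fpowerset A])).
  by move=> F [/face_hull[B BA ->] _]; exists B => //=; rewrite fpowersetE.
by apply: finite_image; apply: finite_fset.
Qed.

Definition verts Q : {fset V} := fset_set (vertices Q).

Lemma mem_verts A v : (v \in verts (hull A)) = (v \in vertices (hull A)).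
Proof. by rewrite in_fset_set //; apply: finite_vertices. Qed.

(** In a set of generators from which none can be dropped, every generator can
    be separated from the hull of the others, hence is a vertex. *)
Theorem hull_verts A : hull A = hull (verts (hull A)).
Proof.
have [n] := ubnP #|` A|; elim: n A => // n IH A An.
have [[v [vA vH]]|noV] := pselect (exists v, v \in A /\ hull (A `\ v)%fset v).
  have <- : hull (A `\ v)%fset = hull A.
    rewrite eqEsubset; split; first by apply: hullS; apply: fsubD1set.
    apply: hull_sub => w wA; have [-> //|wv] := eqVneq w v.
    by apply: hull_mem; rewrite !inE wv.
  by apply: IH; move: An; rewrite (cardfsD1 v A) vA.
congr hull; apply/fsetP => v; rewrite mem_verts; apply/idP/idP => [vA|]; last first.
  by rewrite inE; apply: vertices_hull_sub.
have [|u uv] := @hull_separation (A `\ v)%fset v.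
  by move=> h; apply: noV; exists v.
have Av x : hull A x -> pairing v u <= pairing x u.
  apply: hull_ge => w wA; have [-> //|wv] := eqVneq w v.
  by apply/ltW/uv; rewrite !inE wv.
rewrite inE; exists u, (pairing v u); split=> //.
rewrite face_hull_eq // -[LHS]/([set v]).
have -> : [fset w in A | pairing w u == pairing v u]%fset = [fset v]%fset.
  apply/fsetP => w; rewrite !inE; have [->|wv] := eqVneq w v; first by rewrite vA eqxx.
  apply/negbTE/negP => /andP[/= wA /eqP e]; have := uv w.
  by rewrite !inE wv wA e ltxx => /(_ isT).
rewrite eqEsubset; split=> [x ->|x]; first by apply: hull_mem; rewrite inE.
by move=> /hullP[w []]; rewrite !big_seq_fset1 => _ -> ->; rewrite scale1r.
Qed.

(** * Dimension of a hull *)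

Lemma hull_span A x : hull A x -> homog x \in <<map homog A>>%VS.
Proof.
move=> [c _ ->]; rewrite big_seq memv_suml // => v vA.
by rewrite memvZ // memv_span // map_f.
Qed.

Lemma dim_hull A : dim (hull A) = (\dim <<map homog A>>)%:Z - 1.
Proof.
rewrite /dim; congr (_%:Z - 1); apply/eqP; rewrite eqn_leq; apply/andP; split.
  apply/bigmax_leqP => k /asboolP[s [/eqP fs sA]].
  rewrite -[X in (X <= _)%N](size_tuple s) -(size_map homog) -fs dimvS //.
  by apply/span_subvP => _ /mapP[x xs ->]; apply/hull_span/sA.
have [t [/eqP ft tA <-]] := free_subseq (map homog A).
have [s tE sA] : exists2 s : seq V, t = map homog s & {subset s <= A}.
  elim: t tA {ft} => [|a t IH] tA; first by exists [::].
  have [|s -> sA] := IH; first by move=> x xt; apply: tA; rewrite inE xt orbT.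
  have /mapP[v vA ->] := tA a (mem_head _ _); exists (v :: s) => // w.
  by rewrite inE => /predU1P[->|/sA].
rewrite ft; have td : (size t < d.+2)%N.
  by rewrite -ft (leq_ltn_trans (dimvS (subvf _))) // dim_rV.
have st : size s == size t by rewrite tE size_map.
apply: (@leq_bigmax_cond _ _ (fun i : 'I_d.+2 => i : nat) (Ordinal td)).
apply/asboolP; exists (Tuple st); split=> [|x /= /sA]; last exact: hull_mem.
by rewrite /aff_free /= /free -[map _ s]tE ft.
Qed.

Lemma hull_verts_dim A : dim (hull A) = (\dim <<map homog (verts (hull A))>>)%:Z - 1.
Proof. by rewrite {1}hull_verts dim_hull. Qed.

Lemma dim_lt_card_verts A : dim (hull A) + 1 <= (ncard (vertices (hull A)))%:Z.
Proof.
rewrite hull_verts_dim subrK lez_nat; apply: leq_trans (dim_span _) _.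
by rewrite size_map.
Qed.

(** * Simplices and their facets *)

Lemma aff_free_span (s : seq V) :
  aff_free s -> \dim <<map homog [fset x in s]%fset>> = size s.
Proof.
move=> /eqP; rewrite size_map => <-; congr (\dim _); apply: eq_span => x.
by apply/mapP/mapP => -[y ys ->]; exists y => //; rewrite !inE in ys *.
Qed.

Lemma simplexP A : simplex (hull A) <->
  (ncard (vertices (hull A)))%:Z = dim (hull A) + 1.
Proof.
split=> [[s [fs e]]|].
  apply/eqP; rewrite eq_le dim_lt_card_verts andbT e conv_hull dim_hull.
  rewrite subrK lez_nat aff_free_span //.
  apply: (@leq_trans #|` [fset x in s]%fset|); last first.
    by rewrite card_fseq size_undup.
  apply/fsubset_leq_card/fsubsetP => v; rewrite mem_verts inE.
  exact: vertices_hull_sub.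
rewrite hull_verts_dim subrK => -[e]; exists (enum_fset (verts (hull A))).
split; first by rewrite /aff_free /free size_map; apply/eqP/esym.
by rewrite -hull_fset_conv -hull_verts.
Qed.

Lemma perm_fsetD1 A v : v \in A -> perm_eq A (v :: (A `\ v)%fset).
Proof.
move=> vA; apply: uniq_perm => [||w]; first exact: fset_uniq.
  by rewrite cons_uniq fset_uniq andbT -[_ \in _]/(v \in (A `\ v)%fset) !inE eqxx.
rewrite inE; have [->|wv] := eqVneq w v; first by rewrite [LHS]vA.
by rewrite -[RHS]/(w \in (A `\ v)%fset) !inE wv.
Qed.

(** A vector outside a linear span is not in the cone over the generators and
    their opposites; the functional which separates it vanishes on the span. *)
Lemma simplex_vertex_functional A i : i \in A -> free (map homog A) ->
  exists u c, forall v, v \in A -> c <= pairing v u /\ (pairing v u == c) = (v != i).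
Proof.
move=> iA; rewrite (perm_free (perm_map _ (perm_fsetD1 iA))) /= free_cons.
move=> /andP[iB _]; set B := (A `\ i)%fset in iB.
pose r := [seq (v, b) | v <- B, b <- [:: true; false]].
pose G (j : V * bool) := (if j.2 then 1 else -1) *: homog j.1.
have ur : uniq r by apply: allpairs_uniq; rewrite ?fset_uniq // => -[? ?] [].
have [|p pr pi] := @farkas R _ _ r G (homog i) ur.
  apply: contra_not (negP iB) => -[c _ ->]; rewrite big_seq memv_suml // => j.
  by case/allpairsP => -[v b] [vB _ ->]; rewrite !memvZ // memv_span // map_f.
have pB v : v \in B -> pairing (homog v) p = 0.
  move=> vB; apply/eqP; rewrite eq_le; apply/andP; split.
    have := pr (v, false); rewrite allpairs_f // => /(_ isT).
    by rewrite pairingZl mulN1r oppr_ge0.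
  have := pr (v, true); rewrite allpairs_f // => /(_ isT).
  by rewrite pairingZl mul1r.
exists (- rsubmx p), (lsubmx p 0 0) => v vA; rewrite pairingNr.
have [->|vi] := eqVneq v i.
  move: pi; rewrite homogE => pi.
  have lt : lsubmx p 0 0 < - pairing i (rsubmx p) by rewrite -subr_gt0; lra.
  by rewrite ltW // gt_eqF.
have : pairing (homog v) p = 0 by apply: pB; rewrite !inE vi.
rewrite homogE => e; have -> : - pairing v (rsubmx p) = lsubmx p 0 0 by lra.
by rewrite lexx eqxx.
Qed.

(** A face is the hull of the generators it contains, and the dimension of the hull
    of affinely independent points is their number minus one, so the facets arise
    by omitting one vertex. *)
Lemma simplex_facets (s : seq V) : aff_free s -> ncard (facets (conv s)) = size s.
Proof.
move=> fs; have us : uniq s by apply: map_uniq (free_uniq fs).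
have As : perm_eq [fset x in s]%fset s.
  apply: uniq_perm => [||x]; [exact: fset_uniq|exact: us|].
  by rewrite -[LHS]/(x \in [fset x in s]%fset) inE.
rewrite conv_hull; move: [fset x in s]%fset As => A As.
have fA : free (map homog A) by rewrite (perm_free (perm_map homog As)).
have freeS B : (B `<=` A)%fset -> \dim <<map homog B>> = #|` B|.
  move=> /fsubsetP BA; have : free (map homog B).
    have [t pt] : exists t, perm_eq A (B ++ t).
      exists (A `\` B)%fset; apply: uniq_perm; first exact: fset_uniq.
        rewrite cat_uniq !fset_uniq andbT /=; apply/hasPn => x.
        by rewrite -[_ \in _]/(x \in (A `\` B)%fset) !inE => /andP[].
      move=> x; rewrite mem_cat.
      change ((x \in A) = (x \in B) || (x \in (A `\` B)%fset)).
      by rewrite in_fsetD; case: (boolP (x \in B)) => [/BA ->|].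
    by move: fA; rewrite (perm_free (perm_map homog pt)) map_cat; apply: catl_free.
  by rewrite /free size_map => /eqP.
have -> : size s = #|` A| by rewrite -(perm_size As).
have facetsE : facets (hull A) = (fun i => hull (A `\ i)%fset) @` [set` A].
  rewrite eqEsubset; split=> F.
    move=> [/face_hull[B BA ->]]; rewrite !dim_hull !freeS // => cB.
    have /fset0Pn[i] : (A `\` B)%fset != fset0.
      apply/negP => /eqP AB; have := cardfsD A B.
      by rewrite AB cardfs0 (fsetIidPr BA); lia.
    rewrite inE => /andP[iB iA]; exists i => //; congr hull; apply/eqP.
    rewrite eq_sym eqEfcard fsubsetD1 BA iB /=.
    move: cB (cardfsD1 i A); rewrite iA add1n.
    by move: #|` A| #|` (A `\ i)%fset| #|` B| => a b c; lia.
  case=> i iA <-; split; last first.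
    rewrite !dim_hull !freeS // ?fsubD1set //.
    by have := cardfsD1 i A; rewrite iA add1n; lia.
  have [u [c uc]] := simplex_vertex_functional iA fA.
  have Ac x : hull A x -> c <= pairing x u by apply: hull_ge => v /uc[].
  exists u, c; split=> //; rewrite face_hull_eq //; congr hull.
  apply/fsetP => v; rewrite in_fsetD1 !inE /=.
  have [vA|] := boolP (v \in A); last by rewrite andbF.
  by rewrite (uc v vA).2 andbT.
rewrite /ncard; have -> : fset_set (facets (hull A)) =
    [fset hull (A `\ i)%fset | i in A]%fset.
  apply/fsetP => F; rewrite in_fset_set; last exact: finite_facets.
  rewrite facetsE; apply/idP/imfsetP => /=.
    by rewrite inE => -[i iA <-]; exists i.
  by case=> i iA ->; rewrite inE; exists i.
rewrite card_in_imfset // => i j iA jA /= e; apply/eqP/negPn/negP => ij.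
have : hull (A `\ j)%fset i by apply: hull_mem; rewrite !inE ij.
rewrite -e => iH; have [u [c uc]] := simplex_vertex_functional iA fA.
have [ci ciE] := uc i iA; have : pairing i u == c; last by rewrite ciE eqxx.
move: iH => /hullP[w [_ w1 ->]]; apply/eqP.
rewrite pairing_suml -[RHS]mul1r -w1 mulr_suml; apply: eq_big_seq => v.
rewrite -[_ \in _]/(v \in (A `\ i)%fset) !inE => /andP[vi vA].
by rewrite pairingZl; move: (uc v vA).2; rewrite vi => /eqP ->.
Qed.

End Hull.

(** * Facets of a polytope and vertices of its dual *)

Section Dual.
Variables (R : realType) (d : nat).
Local Notation V := 'rV[R]_d.
Implicit Types (A B : {fset V}) (F Q K : set V) (x u v w z : V).

Definition absorbing K := forall z, exists2 e : R, 0 < e & K (e *: z).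

Lemma interior_absorbing K : K° 0 -> absorbing K.
Proof.
move=> /nbhs_ballP[e /= e0 eK] z.
have n0 : 0 < `|z| + 1 by rewrite ltr_wpDl.
exists (e / (`|z| + 1)); first by rewrite divr_gt0.
apply: eK; rewrite -ball_normE /= sub0r normrN normrZ gtr0_norm ?divr_gt0 //.
by rewrite mulrAC ltr_pdivrMr // ltr_pM2l // ltrDl.
Qed.

Lemma vertex_mem K v : vertices K v -> K v.
Proof. by move=> [u [c [_ e]]]; have : [set v] v by []; rewrite e => -[]. Qed.

Lemma vertices_face K F v : F `<=` K -> vertices K v -> F v -> vertices F v.
Proof.
move=> FK [u [c [Kc e]]] Fv; exists u, c; split=> [x /FK/Kc //|].
rewrite eqEsubset; split=> [x ->|x [/FK Kx xu]]; last by rewrite e.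
by split=> //; have : [set v] v by []; rewrite e => -[].
Qed.

Lemma vertex_neq0 K v : (0 < d)%N -> absorbing K -> vertices K v -> v != 0.
Proof.
move=> d0 Kabs vK; apply/eqP => v0; move: vK; rewrite v0 => -[u [c [Kc e]]].
have c0 : c = 0.
  by have : [set (0 : V)] 0 by []; rewrite e => -[_ /=]; rewrite pairing0l.
have u0 : u = 0.
  have [a a0 /Kc] := Kabs (- u); rewrite c0 pairingZl pairingNl mulrN oppr_ge0.
  rewrite pmulr_rle0 // => uu; apply/eqP; rewrite -pairing_self_eq0.
  by rewrite eq_le uu pairing_self_ge0.
have [a a0 Ka] := Kabs (const_mx 1).
have : [set (0 : V)] (a *: const_mx 1) by rewrite e; split; rewrite //= u0 pairing0r c0.
move=> /rowP/(_ (Ordinal d0)); rewrite !mxE mulr1 => a00.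
by rewrite a00 ltxx in a0.
Qed.

Lemma vertex_between K v x y t : vertices K v -> K x -> K y -> 0 < t -> t < 1 ->
  v = x + t *: (y - x) -> x = v.
Proof.
move=> [u [c [Kc e]]] Kx Ky t0 t1 vE.
have vc : pairing v u = c by have : [set v] v by []; rewrite e => -[].
have := Kc _ Kx; have := Kc _ Ky => yc xc.
have xcE : pairing x u = c.
  move: vc; rewrite vE pairingDl pairingZl pairingBl => vc.
  by apply/eqP; rewrite eq_le xc andbT; nra.
by have : [set v] x by rewrite e.
Qed.

Lemma dual_hullP A y :
  dual_polytope (hull A) y <-> forall v, v \in A -> -1 <= pairing v y.
Proof.
split=> [h v vA|h x]; first exact/h/hull_mem.
exact: hull_ge.
Qed.

(** The constraints on the dual that are slack at [m] stay satisfied under a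
    small perturbation; the tight ones are unaffected by [z]. *)
Lemma dual_perturb A m z : dual_polytope (hull A) m ->
  (forall v, v \in A -> pairing v m = -1 -> pairing v z = 0) ->
  exists2 e, 0 < e & forall t, `|t| <= e -> dual_polytope (hull A) (m + t *: z).
Proof.
move=> /dual_hullP mA tz.
suff [e e0 eA] : exists2 e, 0 < e &
    forall v, v \in enum_fset A -> e * `|pairing v z| <= pairing v m + 1.
  exists e => // t te; apply/dual_hullP => v vA; rewrite pairingDr pairingZr.
  have : `|t * pairing v z| <= pairing v m + 1.
    by rewrite normrM (le_trans _ (eA v vA)) // ler_wpM2r.
  by rewrite ler_norml => /andP[]; lra.
have {}mA v : v \in enum_fset A -> -1 <= pairing v m by exact: mA.
have {}tz v : v \in enum_fset A -> pairing v m = -1 -> pairing v z = 0 by exact: tz.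
elim: (enum_fset A) mA tz => [|a s IH] mA tz; first by exists 1.
have [||e e0 es] := IH.
- by move=> v vs; apply: mA; rewrite inE vs orbT.
- by move=> v vs; apply: tz; rewrite inE vs orbT.
have [e' e'0 ea] : exists2 e', 0 < e' & e' * `|pairing a z| <= pairing a m + 1.
  have := mA _ (mem_head _ _); rewrite le_eqVlt => /predU1P[am|am].
    by exists 1; rewrite ?ltr01 // tz ?mem_head // -am normr0; lra.
  have n0 : 0 < `|pairing a z| + 1 by rewrite ltr_wpDl.
  exists ((pairing a m + 1) / (`|pairing a z| + 1)).
    by rewrite divr_gt0 //; lra.
  by rewrite -mulrA ler_piMr ?ler_pdivrMl //; lra.
exists (Num.min e e'); first by rewrite lt_min e0.
move=> v; rewrite inE => /predU1P[->|vs].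
  by apply: le_trans ea; rewrite ler_wpM2r // ge_min lexx orbT.
by apply: le_trans (es v vs); rewrite ler_wpM2r // ge_min lexx.
Qed.

Lemma dual_absorbing A : absorbing (dual_polytope (hull A)).
Proof.
move=> z; have [||e e0 /(_ e)] := @dual_perturb A 0 z.
- by apply/dual_hullP => v _; rewrite pairing0r oppr_le0.
- by move=> v _; rewrite pairing0r => /eqP; rewrite eq_sym oppr_eq0 oner_eq0.
by rewrite add0r gtr0_norm // => /(_ (lexx _)); exists e.
Qed.

(** Both [m + e z] and [m - e z] lie on the nonnegative side of the functional
    that defines the face [F], and [m] lies on its zero level. *)
Lemma face_perturb A F m z : face (dual_polytope (hull A)) F -> F m ->
  (forall v, v \in A -> pairing v m = -1 -> pairing v z = 0) ->
  exists2 e, 0 < e & F (m + e *: z).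
Proof.
move=> [p [c [Qc ->]]] [Qm mc] /(dual_perturb Qm)[e e0 eQ]; exists e => //.
have Qe : dual_polytope (hull A) (m + e *: z) by apply: eQ; rewrite gtr0_norm.
split=> //=; have := Qc _ Qe; have /Qc : dual_polytope (hull A) (m + (- e) *: z).
  by apply: eQ; rewrite normrN gtr0_norm.
rewrite !pairingDl !pairingZl (mc : pairing m p = c) => h1 h2.
by apply/eqP; rewrite eq_le h2 andbT; move: h1 h2; lra.
Qed.

Definition tight A u : {fset V} := [fset v in A | pairing v u == -1]%fset.

Lemma mem_tight A u v : (v \in tight A u) = (v \in A) && (pairing v u == -1).
Proof. by rewrite !inE. Qed.

(** Otherwise the vertex [u] could be moved along [z] inside the face [{u}]. *)
Lemma tight_orth A u z : vertices (dual_polytope (hull A)) u ->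
  (forall v, v \in tight A u -> pairing v z = 0) -> z = 0.
Proof.
move=> uQ uz; have [//|v vA vu|e e0] := @face_perturb _ [set u] u z uQ.
  by apply: uz; rewrite mem_tight vA vu eqxx.
move=> /= /eqP; rewrite -subr_eq0 addrAC subrr add0r scaler_eq0 gt_eqF //=.
by move=> /eqP.
Qed.

Lemma dim_homog_ge A : (\dim <<A>> <= \dim <<map (@homog R d) A>>)%N.
Proof.
pose f : 'Hom('rV[R]_(1 + d), V) := linfun rsubmx.
have -> : <<A>>%VS = (f @: <<map (@homog R d) A>>)%VS.
  rewrite limg_span -map_comp -[in LHS](map_id (enum_fset A)); congr span.
  by apply: eq_map => x /=; rewrite lfunE /= row_mxKr.
by rewrite -[leqRHS](limg_ker_dim f) leq_addl.
Qed.

(** The points [(1, x)], with [x] on the facet of [u], are orthogonal to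
    [(1, u)], and by [tight_orth] their span is not smaller than that allows. *)
Lemma dim_tight A u : vertices (dual_polytope (hull A)) u ->
  \dim <<map (@homog R d) (tight A u)>> = d.
Proof.
move=> uQ; apply/eqP; rewrite eqn_leq; apply/andP; split; last first.
  apply: leq_trans (dim_homog_ge _).
  have := @span_dim_ge R d (tight A u) 0%VS; rewrite dimv0 addn0; apply=> z zA.
  by rewrite memv0; apply/eqP; apply: tight_orth zA.
have := @orth_dim_le R (1 + d) (map (@homog R d) (tight A u)) [:: homog u].
rewrite span_seq1 dim_vline homog_neq0 => orth.
rewrite -ltnS -addn1; apply: orth => _ y /mapP[x xt ->]; rewrite inE => /eqP ->.
move: xt; rewrite -[_ \in _]/(x \in tight A u) mem_tight homog_row.
by move=> /andP[_ /eqP ->]; rewrite subrr.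
Qed.

Lemma tight_face A u : dual_polytope (hull A) u ->
  hull (tight A u) = hull A `&` [set x | pairing x u = -1].
Proof. by move=> uQ; rewrite face_hull_eq. Qed.

Lemma tight_facet A u : dim (hull A) = d%:Z -> vertices (dual_polytope (hull A)) u ->
  facets (hull A) (hull (tight A u)).
Proof.
move=> dA uQ; split; last by rewrite dim_hull dim_tight // dA.
exists u, (-1); split; first exact: (vertex_mem uQ).
by rewrite tight_face //; apply: vertex_mem.
Qed.

Definition ridge A u w : {fset V} := (tight A u `&` tight A w)%fset.

Lemma mem_ridge A u w v : (v \in ridge A u w) =
  [&& v \in A, pairing v u == -1 & pairing v w == -1].
Proof. by rewrite in_fsetI !mem_tight; case: (v \in A). Qed.

Lemma dim_ridge_le A u w : u != w ->
  (\dim <<map (@homog R d) (ridge A u w)>> + 1 <= d)%N.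
Proof.
move=> uw; have fuw : free [:: homog u; homog w].
  rewrite free_cons seq1_free span_seq1 homog_neq0 andbT.
  apply/negP => /vlineP[k] /esym; rewrite scale_row_mx => /eq_row_mx[].
  move=> /matrixP/(_ 0 0); rewrite !mxE mulr1n mulr1 => ->; rewrite scale1r => e.
  by rewrite e eqxx in uw.
have := @orth_dim_le R (1 + d) (map (@homog R d) (ridge A u w)) [:: homog u; homog w].
rewrite (eqP fuw) => orth; rewrite -ltnS -addnS; apply: orth => _ y /mapP[x xt ->].
move: xt; rewrite -[_ \in _]/(x \in ridge A u w) mem_ridge => /and3P[_ /eqP xu /eqP xw].
by rewrite !inE => /orP[]/eqP ->; rewrite homog_row ?xu ?xw subrr.
Qed.

(** Adjacency of facets is expressed by the rank of the vertices that they
    share: this is the form in which it follows from an edge of the dual, and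
    it bounds the number of shared vertices from below. *)
Definition nbrs A u : {fset V} := [fset w in verts (dual_polytope (hull A)) |
  (w != u) && (d <= \dim <<map (@homog R d) (ridge A u w)>> + 1)%N]%fset.

(** Seen from [u], the dual polytope spans the cone over its vertex figure
    [Y], obtained by scaling each [w - u] to the hyperplane on which the sum
    [a] of the generators tight at [u] takes the value [1].  A functional
    exposing a vertex of [Y], corrected by a multiple of [a], exposes an edge of
    the dual polytope at [u]; the constraints that are tight on the edge then have
    only the direction of the edge in their common kernel. *)
Lemma nbrs_cone A u y : polytope (dual_polytope (hull A)) ->
  vertices (dual_polytope (hull A)) u -> dual_polytope (hull A) y ->
  cone (nbrs A u) (fun w => w - u) (y - u).
Proof.
set Q := dual_polytope (hull A) => /polytope_hull[B0 QE0] uQ.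
set B := verts Q; have QE : Q = hull B by rewrite {1}QE0 hull_verts -QE0.
have BQ w : w \in B -> Q w by rewrite QE; apply: hull_mem.
pose T := tight A u; pose a := \sum_(x <- T) x.
pose g w := pairing (w - u) a.
have gE w : g w = \sum_(x <- T) (pairing x w + 1).
  rewrite /g pairing_sumr; apply: eq_big_seq => x; rewrite -[_ \in _]/(x \in tight A u).
  by rewrite mem_tight pairingBl !(pairingC _ x) => /andP[_ /eqP ->]; rewrite opprK.
have ge0 w x : Q w -> x \in T -> 0 <= pairing x w + 1.
  by move=> /dual_hullP Qw; rewrite mem_tight -lerBlDr sub0r => /andP[/Qw].
have g_gt0 w : Q w -> w != u -> 0 < g w.
  move=> Qw; apply: contraNT; rewrite -leNgt gE => g0.
  rewrite -subr_eq0; apply/eqP; apply: tight_orth uQ _ => x xT.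
  have : \sum_(x <- T) (pairing x w + 1) == 0.
    rewrite eq_le g0 big_seq; apply: sumr_ge0 => v; exact: ge0.
  rewrite big_seq psumr_eq0 => [/allP/(_ x xT)|v]; last exact: ge0.
  rewrite [_ \in _]xT /= addr_eq0 => /eqP xw.
  by move: xT; rewrite mem_tight pairingBr xw => /andP[_ /eqP ->]; rewrite subrr.
pose f w := (g w)^-1 *: (w - u).
have fK w : Q w -> w != u -> w - u = g w *: f w.
  by move=> Qw wu; rewrite scalerA divff ?scale1r // gt_eqF // g_gt0.
pose Y := hull [fset f w | w in (B `\ u)%fset]%fset.
have Yf w : w \in B -> w != u -> Y (f w).
  by move=> wB wu; apply/hull_mem/in_imfset; rewrite /= !inE wu.
have nbr_edge x : x \in verts Y -> exists2 w, w \in nbrs A u & x = f w.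
  rewrite mem_verts inE => xY; have := vertices_hull_sub xY.
  case/imfsetP => w /=; rewrite in_fsetD1 => /andP[wu wB] xE; exists w => //.
  move: xY; rewrite xE => -[p [c [Yc fwE]]].
  (* On [Y] the functional [q] is [p - c], but unlike [p - c] it is linear, so
     its sign at [w' - u] can be read off at [f w']. *)
  pose q := p - c *: a.
  have qE w' : w' \in B -> w' != u ->
      pairing (w' - u) q = g w' * (pairing (f w') p - c).
    move=> w'B w'u; rewrite {1}(fK _ (BQ _ w'B) w'u) pairingZl pairingBr pairingZr.
    congr (_ * (_ - _)); rewrite /f pairingZl -/(g w') mulVf ?mulr1 //.
    by rewrite gt_eqF // g_gt0 //; apply: BQ.
  have q_ge0 w' : w' \in B -> pairing u q <= pairing w' q.
    move=> w'B; have [-> //|w'u] := eqVneq w' u.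
    rewrite -subr_ge0 -pairingBl qE // mulr_ge0 ?subr_ge0 //; last exact/Yc/Yf.
    by apply/ltW/g_gt0 => //; apply: BQ.
  have q_eq0 w' : w' \in B -> pairing w' q = pairing u q -> w' - u \in <[w - u]>%VS.
    move=> w'B w'q; have [->|w'u] := eqVneq w' u; first by rewrite subrr mem0v.
    have : pairing (w' - u) q = 0 by rewrite pairingBl w'q subrr.
    move/eqP; rewrite qE // mulf_eq0 gt_eqF /=; last by apply: g_gt0 => //; apply: BQ.
    rewrite subr_eq0 => /eqP w'c; have : [set f w] (f w').
      by rewrite fwE; split=> //; apply: Yf.
    move=> /= e; rewrite (fK _ (BQ _ w'B) w'u) e memvZ // /f memvZ //.
    exact: memv_line.
  pose G := Q `&` [set x | pairing x q = pairing u q].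
  have GQ : face Q G.
    by exists q, (pairing u q); split=> // x'; rewrite QE; apply: hull_ge.
  have Gline x' : G x' -> x' - u \in <[w - u]>%VS.
    rewrite /G QE face_hull_eq; last by move=> v; apply: hull_ge.
    move=> /hullP[l [_ l1 ->]].
    rewrite -[X in _ - X]scale1r -l1 scaler_suml -sumrB big_seq memv_suml // => v.
    rewrite !inE -scalerBr => /andP[vB /eqP vq]; rewrite memvZ // q_eq0 //.
  have wq : pairing w q = pairing u q.
    apply/eqP; rewrite -subr_eq0 -pairingBl qE //.
    have : [set f w] (f w) by []; rewrite fwE => -[_ /= ->].
    by rewrite subrr mulr0.
  (* At the midpoint exactly the constraints tight at both ends are tight. *)
  pose m := 2^-1 *: (u + w).
  have mG : G m.
    split; last first.
      by rewrite /= pairingZl pairingDl wq; lra.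
    apply/dual_hullP => v vA; rewrite pairingZr pairingDr.
    have /dual_hullP/(_ v vA) := vertex_mem uQ.
    have /dual_hullP/(_ v vA) := BQ _ wB.
    by lra.
  have orth z : (forall x, x \in ridge A u w -> pairing x z = 0) -> z \in <[w - u]>%VS.
    move=> zr; have [v vA vm|e e0 /Gline] := face_perturb (z := z) GQ mG.
      apply: zr; rewrite mem_ridge vA /=.
      have /dual_hullP/(_ v vA) := vertex_mem uQ.
      have /dual_hullP/(_ v vA) := BQ _ wB.
      move: vm; rewrite pairingZr pairingDr => vm h1 h2.
      by apply/andP; split; rewrite eq_le ?h1 ?h2 andbT; lra.
    have -> : m + e *: z - u = 2^-1 *: (w - u) + e *: z.
      by apply/rowP => i; rewrite /m !mxE; lra.
    rewrite rpredDl => [ez|]; last by rewrite memvZ ?memv_line.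
    have -> : z = e^-1 *: (e *: z) by rewrite scalerA mulVf ?scale1r ?gt_eqF.
    exact: memvZ.
  rewrite /nbrs !inE; apply/and3P; split=> //.
  apply: leq_trans (span_dim_ge orth) _; rewrite leq_add ?dim_homog_ge //.
  by rewrite dim_vline; case: (_ != 0).
have cone_nbr w : w \in B -> cone (nbrs A u) (fun w => w - u) (w - u).
  move=> wB; have [->|wu] := eqVneq w u; first by rewrite subrr; apply: cone0.
  rewrite fK //; last exact: BQ.
  apply: coneZ; first by apply/ltW/g_gt0 => //; apply: BQ.
  have := Yf w wB wu; rewrite /Y hull_verts => /hullP[c [c0 _ ->]].
  apply: cone_sum => x /nbr_edge[w' w'n ->]; do 2?apply: coneZ => //.
    rewrite invr_ge0; move: w'n; rewrite !inE => /and3P[w'B w'u _].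
    by apply/ltW/g_gt0 => //; apply: BQ.
  exact: (@cone_gen _ _ _ _ (fun w => w - u)) w'n (fset_uniq _).
rewrite {1}QE => /hullP[c [c0 c1 ->]].
rewrite -[X in _ - X]scale1r -c1 scaler_suml -sumrB; apply: cone_sum => w wB.
by rewrite -scalerBr; apply: coneZ => //; apply: cone_nbr.
Qed.

End Dual.

(** * The neighbours of a vertex of the dual *)

Section Neighbours.
Variables (R : realType) (d : nat).
Local Notation V := 'rV[R]_d.
Implicit Types (A : {fset V}) (u v w x z : V) (t : seq V).

Definition proj u w : V := w - (pairing w u / pairing u u) *: u.

Lemma pairing_proj u w x : pairing x u = 0 -> pairing x (proj u w) = pairing x w.
Proof. by move=> xu; rewrite pairingBr pairingZr xu mulr0 subr0. Qed.

Lemma proj_orth u w : u != 0 -> pairing (proj u w) u = 0.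
Proof.
move=> u0; rewrite pairingBl pairingZl divfK ?subrr //.
by rewrite pairing_self_eq0.
Qed.

Lemma nbrs_cone_proj A u z : polytope (dual_polytope (hull A)) ->
  vertices (dual_polytope (hull A)) u -> u != 0 -> pairing z u = 0 ->
  cone (nbrs A u) (proj u) z.
Proof.
move=> Qpol uQ u0 zu; have uu : pairing u u != 0 by rewrite pairing_self_eq0.
have [e e0 ezQ] := dual_absorbing A z.
have [c c0 cE] := nbrs_cone Qpol uQ ezQ.
suff : cone (nbrs A u) (proj u) (e *: z).
  move=> /(coneZ (a := e^-1)); rewrite invr_ge0 ltW // scalerA mulVf ?gt_eqF //.
  by rewrite scale1r; apply.
exists c => //; have -> : e *: z = proj u (e *: z - u).
  rewrite /proj pairingBl pairingZl zu mulr0 sub0r mulNr divff // scaleN1r.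
  by rewrite opprK subrK.
rewrite cE /proj pairing_suml mulr_suml scaler_suml -sumrB.
apply: eq_bigr => w _; rewrite pairingZl pairingBl -mulrA -scalerA -scalerBr.
congr (_ *: _); rewrite mulrBl divff // scalerBl scale1r opprB addrA subrK.
by [].
Qed.

Lemma cone_proj_cover t u x : pairing x u = 0 -> x != 0 -> cone t (proj u) (- x) ->
  exists2 w, w \in t & pairing x w < 0.
Proof.
move=> xu x0 [c c0 xE]; apply: contrapT => nw.
have : 0 <= pairing x (- x).
  rewrite xE pairing_sumr big_seq; apply: sumr_ge0 => w wt.
  rewrite pairingZr pairing_proj // mulr_ge0 // leNgt; apply/negP => xw.
  by apply: nw; exists w.
rewrite pairingNr oppr_ge0 => xx; move: x0; rewrite -pairing_self_eq0.
by rewrite eq_le xx pairing_self_ge0.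
Qed.

(** The projections of the neighbours of [u] along [u] positively span a space of
    dimension at most [d - 1]. *)
Lemma nbrs_steinitz A u : polytope (dual_polytope (hull A)) ->
  vertices (dual_polytope (hull A)) u -> u != 0 ->
  exists t, [/\ {subset t <= nbrs A u}, (size t <= 2 * d.-1)%N &
    forall z, pairing z u = 0 -> cone t (proj u) z].
Proof.
move=> Qpol uQ u0; set W := nbrs A u.
have [z|t [_ tW st tz]] := @steinitz R V V W (proj u) (fset_uniq _).
  move=> zW; apply: nbrs_cone_proj => //; apply: span_orth zW => _ /mapP[w _ ->].
  exact: proj_orth.
exists t; split=> //.
  apply: leq_trans st _; rewrite leq_mul2l /=.
  have := @orth_dim_le R d (map (proj u) W) [:: u].
  rewrite span_seq1 dim_vline u0 addn1 => dW; rewrite -ltnS.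
  suff h : (\dim <<map (proj u) W>> < d)%N by rewrite (ltn_predK h).
  apply: dW => _ y /mapP[w _ ->]; rewrite inE => /eqP ->; exact: proj_orth.
move=> z zu; apply: tz; have [c _ ->] := nbrs_cone_proj Qpol uQ u0 zu.
rewrite big_seq memv_suml // => w wW; rewrite memvZ // memv_span //.
exact: map_f.
Qed.

Lemma mem_nbrs A u w : polytope (dual_polytope (hull A)) -> w \in nbrs A u ->
  [/\ vertices (dual_polytope (hull A)) w, w != u &
    (d <= \dim <<map (@homog R d) (ridge A u w)>> + 1)%N].
Proof.
move=> /(@polytope_hull R d)[B QE]; rewrite !inE => /and3P[wQ wu wd]; split=> //.
by move: wQ; rewrite -[_ \in _]/(w \in verts _) QE mem_verts inE.
Qed.

(** One of three collinear points lies between the other two. *)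
Lemma collinear_vertices (K : set V) u w x (t : R) : vertices K u -> vertices K w ->
  vertices K x -> w != u -> x != u -> x = u + t *: (w - u) -> x = w.
Proof.
move=> uK wK xK wu xu xE.
have [t0|t0|t0] := ltgtP t 0; last by rewrite xE t0 scale0r addr0 eqxx in xu.
  have s0 : 0 < 1 - t by lra.
  have uE : u = w + (1 - t)^-1 *: (x - w).
    have -> : x - w = (1 - t) *: (u - w).
      by rewrite xE; apply/rowP => i; rewrite !mxE; ring.
    by rewrite scalerA mulVf ?gt_eqF // scale1r addrC subrK.
  have := vertex_between uK (vertex_mem wK) (vertex_mem xK) _ _ uE.
  rewrite invr_gt0 s0 invf_lt1 // => e; move: wu.
  by rewrite e ?eqxx //; lra.
have [t1|t1|t1] := ltgtP t 1; last by rewrite xE t1 scale1r addrC subrK.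
  have e := vertex_between xK (vertex_mem uK) (vertex_mem wK) t0 t1 xE.
  by rewrite -e eqxx in xu.
have wE : w = u + t^-1 *: (x - u).
  rewrite xE [u + _ - u]addrAC subrr add0r scalerA mulVf ?gt_eqF // scale1r.
  by rewrite addrC subrK.
have := vertex_between wK (vertex_mem uK) (vertex_mem xK) _ _ wE.
by rewrite invr_gt0 t0 invf_lt1 // => e; rewrite e ?eqxx // in wu.
Qed.

(** A ridge determines [u] and the neighbour up to the position of the latter on a
    line through [u], on which a polytope has at most two vertices. *)
Lemma ridge_inj A u w w' : polytope (dual_polytope (hull A)) ->
  vertices (dual_polytope (hull A)) u -> w \in nbrs A u -> w' \in nbrs A u ->
  hull (ridge A u w) = hull (ridge A u w') -> w = w'.
Proof.
move=> Qpol uQ /(mem_nbrs Qpol)[wQ wu wd] /(mem_nbrs Qpol)[w'Q w'u _] e.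
have rw' v : v \in ridge A u w -> pairing v w' = -1.
  move=> /hull_mem; rewrite e => /hullP[c [_ c1 ->]].
  rewrite pairing_suml -[RHS]mul1r -{1}c1 mulr_suml; apply: eq_big_seq => y.
  rewrite -[_ \in _]/(y \in ridge A u w') mem_ridge pairingZl.
  by move=> /and3P[_ _ /eqP ->].
have inspan : homog w' \in <<[:: homog u; homog w]>>%VS.
  apply: contraT => nin.
  have : free [:: homog w'; homog u; homog w].
    rewrite free_cons nin free_cons seq1_free homog_neq0 span_seq1 andbT /=.
    apply/negP => /vlineP[k] /esym; rewrite scale_row_mx => /eq_row_mx[].
    move=> /matrixP/(_ 0 0); rewrite !mxE mulr1n mulr1 => ->; rewrite scale1r => wuE.
    by rewrite wuE eqxx in wu.
  move=> /eqP f3; have := @orth_dim_le R (1 + d) (map (@homog R d) (ridge A u w))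
    [:: homog w'; homog u; homog w]; rewrite f3 /= => h.
  have : (\dim <<map (@homog R d) (ridge A u w)>> + 3 <= 1 + d)%N;
    last by move: wd; clear; lia.
  apply: h => _ y /mapP[v vr ->]; change (is_true (v \in ridge A u w)) in vr.
  rewrite !inE => /or3P[]/eqP ->; rewrite homog_row.
  - by rewrite rw' ?subrr.
  - by move: (vr); rewrite mem_ridge => /and3P[_ /eqP -> _]; rewrite subrr.
  - by move: (vr); rewrite mem_ridge => /and3P[_ _ /eqP ->]; rewrite subrr.
move: inspan; rewrite span_cons span_seq1.
move=> /memv_addP[_ /vlineP[a ->] [_ /vlineP[b ->]]].
rewrite !scale_row_mx add_row_mx => /eq_row_mx[/matrixP/(_ 0 0)].
rewrite !mxE !mulr1n !mulr1 => ab w'E.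
apply/esym; apply: (@collinear_vertices (dual_polytope (hull A)) u w w' b) => //.
rewrite w'E; have -> : a = 1 - b by rewrite ab addrK.
by apply/rowP => i; rewrite !mxE; ring.
Qed.

Lemma ridge_facet A u w : vertices (dual_polytope (hull A)) u ->
  polytope (dual_polytope (hull A)) -> w \in nbrs A u ->
  facets (hull (tight A u)) (hull (ridge A u w)).
Proof.
move=> uQ Qpol /(mem_nbrs Qpol)[wQ wu wd]; split; last first.
  rewrite !dim_hull dim_tight //; have := @dim_ridge_le _ _ A u w.
  by rewrite eq_sym => /(_ wu); move: wd; lia.
exists w, (-1).
have wT v : v \in tight A u -> -1 <= pairing v w.
  have /dual_hullP h := vertex_mem wQ.
  by rewrite mem_tight => /andP[/h].
have wH x : hull (tight A u) x -> -1 <= pairing x w by apply: hull_ge.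
split=> //; rewrite face_hull_eq //; congr hull; apply/fsetP => v.
by rewrite mem_ridge !inE /= andbA.
Qed.

End Neighbours.

(** * Counting the vertices *)

Section Counting.
Variables (R : realType) (d : nat).
Local Notation V := 'rV[R]_d.
Implicit Types (A : {fset V}) (u v w x z : V) (t : seq V).

Lemma lattice_pairing x y : @lattice_points R d x -> @lattice_points R d y ->
  pairing x y \is a Num.int.
Proof.
move=> /mxOverP xi /mxOverP yi; rewrite pairingE rpred_sum // => i _.
by rewrite rpredM.
Qed.

Lemma int_neg_eq (a : R) : a \is a Num.int -> -1 <= a -> a < 0 -> a = -1.
Proof.
move=> /intrP[m ->]; rewrite -(intrN _ 1) ler_int ltrz0 => h1 h2.
by congr (_%:~R); lia.
Qed.

Lemma int_gt0_ge1 (a : R) : a \is a Num.int -> 0 < a -> 1 <= a.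
Proof. by move=> /intrP[m ->]; rewrite ltr0z -[1]/(1%:~R) ler_int => ?; lia. Qed.

Lemma card_fset_cond (T : choiceType) (N : {fset T}) (p : pred T) :
  \sum_(x <- N) (p x)%:R = (#|` [fset x in N | p x]%fset|)%:R :> R.
Proof.
rewrite -natr_sum; congr (_%:R); rewrite -big_mkcond /= sum1_count -size_filter.
apply: perm_size; apply: uniq_perm; rewrite ?filter_uniq ?fset_uniq // => x.
by rewrite mem_filter -[RHS]/(x \in [fset x in N | p x]%fset) !inE andbC.
Qed.

Lemma card_cover (T : choiceType) (N : {fset T}) (f : V -> {fset T}) t k :
  (forall x : T, x \in N -> exists2 w, w \in t & x \in f w) ->
  (forall w, w \in t -> #|` f w| <= k)%N -> (#|` N| <= size t * k)%N.
Proof.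
elim: t N => [|w t IH] N Nt fk /=.
  rewrite mul0n leqn0 cardfs_eq0; apply/eqP/fsetP => x; rewrite inE.
  by apply/negP => /Nt[].
rewrite mulSn -(cardfsID (f w)) leq_add //.
  apply: leq_trans (fk w (mem_head _ _)); apply: fsubset_leq_card.
  by rewrite fsubsetIr.
apply: IH => [x|v vt]; last by apply: fk; rewrite inE vt orbT.
rewrite inE => /andP[xw /Nt[v]]; rewrite inE => /predU1P[->|vt xv].
  by rewrite (negbTE xw).
by exists v.
Qed.

Lemma le_bigmax_fset (T : choiceType) (N : {fset T}) (f : T -> nat) (x : T) :
  x \in N -> (f x <= \max_(y <- N) f y)%N.
Proof. by move=> xN; apply: leq_bigmax_seq. Qed.

Lemma card_vertices_le A F : facets (hull A) F ->
  (ncard (vertices F) <= max_vertices (hull A))%N.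
Proof.
move=> FA; rewrite /max_vertices.
apply: (@le_bigmax_fset _ _ (fun F => ncard (vertices F))).
by rewrite in_fset_set ?inE //; apply: finite_facets.
Qed.

Lemma card_facets_le A F : facets (hull A) F ->
  (ncard (facets F) <= max_facets (hull A))%N.
Proof.
move=> FA; rewrite /max_facets.
apply: (@le_bigmax_fset _ _ (fun F => ncard (facets F))).
by rewrite in_fset_set ?inE //; apply: finite_facets.
Qed.

Lemma dim_le_max_vertices A F : dim (hull A) = d%:Z -> facets (hull A) F ->
  (d <= max_vertices (hull A))%N.
Proof.
move=> dA FA; apply: leq_trans (card_vertices_le FA).
case: FA => /face_hull[B _ ->] dF; have := dim_lt_card_verts B.
by rewrite dF dA subrK.
Qed.

Lemma mem_vertices A x : verts (hull A) = A -> x \in A -> vertices (hull A) x.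
Proof. by move=> <-; rewrite -hull_verts mem_verts inE. Qed.

Lemma card_tight_le A u : dim (hull A) = d%:Z -> verts (hull A) = A ->
  vertices (dual_polytope (hull A)) u -> (#|` tight A u| <= max_vertices (hull A))%N.
Proof.
move=> dA vA uQ; apply: leq_trans (card_vertices_le (tight_facet dA uQ)).
apply: fsubset_leq_card; apply/fsubsetP => v vu; rewrite mem_verts inE.
apply: (@vertices_face R d (hull A)); last exact: hull_mem.
  by apply: hullS; apply/fsubsetP => x; rewrite mem_tight => /andP[].
by move: vu; rewrite mem_tight => /andP[/(mem_vertices vA)].
Qed.

(** The two facets share at least [d - 1] affinely independent vertices. *)
Lemma card_tightD_le A u w : dim (hull A) = d%:Z -> verts (hull A) = A ->
  polytope (dual_polytope (hull A)) -> w \in nbrs A u ->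
  (#|` (tight A w `\` tight A u)%fset| + d.-1 <= max_vertices (hull A))%N.
Proof.
move=> dA vA Qpol /(mem_nbrs Qpol)[wQ wu wd].
apply: leq_trans (card_tight_le dA vA wQ).
rewrite -(cardfsID (tight A u) (tight A w)) addnC leq_add2r fsetIC.
rewrite -subn1 leq_subLR addnC; apply: leq_trans wd _; rewrite leq_add2r.
by apply: leq_trans (dim_span _) _; rewrite size_map.
Qed.

(** Since [0] is a convex combination of the vertices of the dual, one of them is
    nonpositive on the sum of the vertices. *)
Lemma special_vertex A s : polytope (dual_polytope (hull A)) ->
  exists2 u, vertices (dual_polytope (hull A)) u & pairing s u <= 0.
Proof.
move=> Qpol; have [B QE] := polytope_hull Qpol.
have Q0 : hull (verts (hull B)) 0.
  rewrite -hull_verts -QE; apply/dual_hullP => v _.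
  by rewrite pairing0r oppr_le0.
have [|u uB umin] :=
    @exists_argmin R _ (fun u => pairing s u) (enum_fset (verts (hull B))).
  have /fset0Pn[x xB] := hull_neq0 Q0; apply/eqP => h.
  by move: xB; rewrite -[_ \in _]/(x \in enum_fset (verts (hull B))) h.
exists u.
  by move: uB; rewrite QE -[_ \in _]/(u \in verts (hull B)) mem_verts inE.
rewrite -(pairing0r s) [leRHS]pairingC; apply: hull_ge Q0 => v vB.
by rewrite (pairingC v) umin.
Qed.

(** The heights [<x, u>] are integers, at least [-1], of sum at most [0]. *)
Lemma card_positive_le A u :
  {in A, forall x, @lattice_points R d x} -> @lattice_points R d u ->
  dual_polytope (hull A) u -> pairing (\sum_(x <- A) x) u <= 0 ->
  (#|` [fset x in A | (0 < pairing x u)%R]%fset| <= #|` tight A u|)%N.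
Proof.
move=> Alat ulat /dual_hullP uA; rewrite pairing_suml => s0.
rewrite -(ler_nat R) -!card_fset_cond -subr_le0 -sumrB.
apply: le_trans s0; rewrite big_seq [leRHS]big_seq; apply: ler_sum => x xA.
have xu := lattice_pairing (Alat x xA) ulat.
have [p0|p0|p0] := ltgtP 0 (pairing x u).
- have -> : (pairing x u == -1) = false by rewrite gt_eqF //; lra.
  by rewrite subr0 int_gt0_ge1.
- by rewrite (int_neg_eq xu (uA _ xA) p0) eqxx sub0r.
- by rewrite -p0 eq_sym oppr_eq0 oner_eq0 subrr.
Qed.

(** The facet of [u] carries at most [alpha] vertices, and at most as many have
    positive height.  The remaining ones are orthogonal to [u], hence lie on a
    neighbouring facet, which shares at least [d - 1] vertices with that of
    [u]. *)
Lemma card_vertices_bound A u t : (0 < d)%N -> dim (hull A) = d%:Z ->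
  verts (hull A) = A -> absorbing (hull A) ->
  {in A, forall x, @lattice_points R d x} ->
  lattice_polytope (dual_polytope (hull A)) ->
  vertices (dual_polytope (hull A)) u -> pairing (\sum_(x <- A) x) u <= 0 ->
  {subset t <= nbrs A u} -> (forall z, pairing z u = 0 -> cone t (proj u) z) ->
  (#|` A| <= 2 * max_vertices (hull A) + size t * (max_vertices (hull A) + 1 - d))%N.
Proof.
move=> d0 dA vA Aabs Alat [Qpol Qlat] uQ su tW tz.
pose N0 := [fset x in A | pairing x u == 0%R]%fset.
pose NP := [fset x in A | (0 < pairing x u)%R]%fset.
have /dual_hullP uA := vertex_mem uQ.
have ulat := Qlat _ uQ.
have AE : (A `<=` tight A u `|` N0 `|` NP)%fset.
  apply/fsubsetP => x xA; rewrite !inE xA /=.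
  have xu := lattice_pairing (Alat x xA) ulat.
  have [p0|p0|_] := ltgtP 0 (pairing x u); rewrite ?orbT //.
  by rewrite (int_neg_eq xu (uA _ xA) p0) eqxx.
have cT := card_tight_le dA vA uQ.
have cP := card_positive_le Alat ulat (vertex_mem uQ) su.
have c0 : (#|` N0| <= size t * (max_vertices (hull A) + 1 - d))%N.
  apply: (@card_cover _ _ (fun w => tight A w `\` tight A u)%fset) => [x|w /tW wW];
      last first.
    by have := card_tightD_le dA vA Qpol wW; lia.
  rewrite !inE => /andP[xA /eqP xu].
  have x0 : x != 0.
    by apply: (vertex_neq0 d0 Aabs); apply: mem_vertices xA.
  have [|w wt xw] := cone_proj_cover xu x0 (t := t).
    by apply: tz; rewrite pairingNl xu oppr0.
  have [wQ _ _] := mem_nbrs Qpol (tW _ wt); exists w => //.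
  rewrite inE !mem_tight xA xu eq_sym oppr_eq0 oner_eq0 /=; apply/eqP/int_neg_eq => //.
    by apply: lattice_pairing; [apply: Alat|apply: Qlat].
  by have /dual_hullP := vertex_mem wQ; apply.
apply: leq_trans (fsubset_leq_card AE) _.
have := cardfsU (tight A u `|` N0)%fset NP; have := cardfsU (tight A u) N0.
by move: cT cP c0; rewrite -/NP; lia.
Qed.

Lemma card_nbrs_le A u : dim (hull A) = d%:Z ->
  polytope (dual_polytope (hull A)) -> vertices (dual_polytope (hull A)) u ->
  (#|` nbrs A u| <= max_facets (hull A))%N.
Proof.
move=> dA Qpol uQ; apply: leq_trans (card_facets_le (tight_facet dA uQ)).
have <- : #|` [fset hull (ridge A u w) | w in nbrs A u]%fset| = #|` nbrs A u|.
  by rewrite card_in_imfset // => w w' wW w'W; apply: ridge_inj.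
apply: fsubset_leq_card; apply/fsubsetP => F /imfsetP[w /= wW ->].
rewrite in_fset_set; last exact: finite_facets.
by rewrite inE; apply: ridge_facet.
Qed.

End Counting.

(** * Simplicial polytopes *)

Section Simplicial.
Variables (R : realType) (d : nat) (A : {fset 'rV[R]_d}).
Hypotheses (dA : dim (hull A) = d%:Z) (facetA : exists F, facets (hull A) F).

Lemma facet_card_vertices F : facets (hull A) F ->
  (d <= ncard (vertices F))%N /\ (simplex F <-> ncard (vertices F) = d).
Proof.
move=> [/face_hull[B _ ->] dF].
have dB : dim (hull B) + 1 = d%:Z by rewrite dF dA subrK.
have := dim_lt_card_verts B; rewrite dB lez_nat => dle; split=> //.
by apply: (iff_trans (simplexP B)); rewrite dB; split=> [[]|->].
Qed.

Lemma simplicial_max_vertices :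
  simplicial (hull A) <-> max_vertices (hull A) = d.
Proof.
have [F0 F0A] := facetA; split=> [sA|aE F FA].
  apply/eqP; rewrite eqn_leq (dim_le_max_vertices dA F0A) andbT.
  apply/bigmax_leqP_seq => F; rewrite in_fset_set; last exact: finite_facets.
  rewrite inE => FA _; have [_ /iffLR FP] := facet_card_vertices FA.
  by rewrite FP //; apply: sA.
have [dF FP] := facet_card_vertices FA; apply/FP/eqP.
by rewrite eqn_leq dF andbT -[leqRHS]aE card_vertices_le.
Qed.

Lemma simplicial_max_facets : simplicial (hull A) -> max_facets (hull A) = d.
Proof.
move=> sA; have facetsE F : facets (hull A) F -> ncard (facets F) = d.
  move=> FA; have [s [fs FE]] := sA F FA; rewrite FE simplex_facets //.
  apply/eqP; rewrite -eqz_nat -dA -(subrK 1 (dim (hull A))) -FA.2 FE conv_hull.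
  by rewrite dim_hull subrK aff_free_span.
have [F0 F0A] := facetA; apply/eqP; rewrite eqn_leq; apply/andP; split.
  apply/bigmax_leqP_seq => F; rewrite in_fset_set; last exact: finite_facets.
  by rewrite inE => /facetsE ->.
by rewrite -{1}(facetsE _ F0A) card_facets_le.
Qed.

End Simplicial.

Theorem theorem5p4 (R : realType) (d : nat) (P : set 'rV[R]_d)
    (d_gt0 : (0 < d)%N) (reflP : reflexive_polytope P) :
  let alpha := max_vertices P in
  let beta := max_facets P in
  let v := ncard (vertices P) in
  ([/\ (v <= 2 * d * alpha)%N,
       2 * d%:Z - 3 <= alpha%:Z ->
         v%:Z <= 2 * d%:Z * (alpha%:Z - d%:Z + 2) - 2,
       alpha%:Z <= 2 * d%:Z - 3 ->
         v%:Z <= d%:Z * alpha%:Z + alpha%:Z - d%:Z + 1,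
       simplicial P <-> alpha = d
     & simplicial P -> (3 <= d)%N -> (v <= d ^ 2 + 1)%N])
  /\
  ([/\ (v%:R : R) <= (alpha%:R - d%:R + 1) * beta%:R + 2
         + 2 * Num.sqrt ((alpha%:R - 1) * (d%:R + 1)
                 * ((alpha%:R - 1) + (alpha%:R - d%:R + 1) * beta%:R)),
       simplicial P <-> alpha = d /\ beta = d
     & simplicial P ->
         (v%:R : R) <= d%:R + 2
           + 2 * Num.sqrt ((d%:R ^+ 2 - 1) * (2 * d%:R - 1))]).
Proof.
move=> alpha beta v.
have [[Ppol Plat] dP P0 Qlat] := reflP; have [Qpol _] := Qlat.
have [A0 PA0] := polytope_hull Ppol.
pose A := verts P; have PA : P = hull A by rewrite {1}PA0 hull_verts -PA0.
have vA : verts (hull A) = A by rewrite -PA.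
have Alat : {in A, forall x, @lattice_points R d x}.
  by move=> x /(mem_vertices vA) xP; apply: Plat; rewrite PA.
have Pabs : absorbing P by apply: interior_absorbing.
have vE : v = #|` A| by [].
rewrite PA in dP Pabs Qpol Qlat.
have [u uQ su] := special_vertex (\sum_(x <- A) x) Qpol.
have u0 : u != 0 by apply: vertex_neq0 d_gt0 (dual_absorbing A) uQ.
have facetA : exists F, facets (hull A) F.
  by exists (hull (tight A u)); apply: tight_facet.
have ad : (d <= alpha)%N.
  by have [F FA] := facetA; rewrite /alpha PA; apply: dim_le_max_vertices FA.
(* Applied with a Steinitz subfamily and with all neighbours. *)
have main (t : seq 'rV[R]_d) : {subset t <= nbrs A u} ->
    (forall z, pairing z u = 0 -> cone t (proj u) z) ->
    (v <= 2 * alpha + size t * (alpha + 1 - d))%N.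
  move=> tW tz; rewrite vE /alpha PA.
  exact: card_vertices_bound tz.
have part1 : (v <= 2 * alpha + 2 * d.-1 * (alpha + 1 - d))%N.
  have [t [tW st tz]] := nbrs_steinitz Qpol uQ u0.
  by apply: leq_trans (main t tW tz) _; rewrite leq_add2l leq_mul2r st orbT.
have part2 : (v <= 2 * alpha + beta * (alpha + 1 - d))%N.
  have all_nbrs := main (nbrs A u) (fun _ h => h) (fun z => nbrs_cone_proj Qpol uQ u0).
  apply: leq_trans all_nbrs _.
  by rewrite leq_add2l leq_mul2r /beta PA card_nbrs_le ?orbT.
have simp : simplicial P <-> alpha = d.
  by rewrite /alpha PA; apply: simplicial_max_vertices.
have simpb : simplicial P -> beta = d.
  by rewrite /beta PA; apply: simplicial_max_facets.
have [k aE] : exists k, alpha = (d + k)%N by exists (alpha - d)%N; rewrite subnKC.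
have [n dE] : exists n, d = n.+1 by exists d.-1; rewrite prednK.
have bound2 : (v%:R : R) <= (alpha%:R - d%:R + 1) * beta%:R + 2
         + 2 * Num.sqrt ((alpha%:R - 1) * (d%:R + 1)
                 * ((alpha%:R - 1) + (alpha%:R - d%:R + 1) * beta%:R)).
  have a1 : 1 <= alpha%:R :> R by rewrite ler1n (leq_trans d_gt0).
  have d1 : 1 <= d%:R :> R by rewrite ler1n.
  have da : d%:R <= alpha%:R :> R by rewrite ler_nat.
  have b0 : 0 <= beta%:R :> R by [].
  have sq : alpha%:R - 1 <= Num.sqrt ((alpha%:R - 1) * (d%:R + 1) *
      ((alpha%:R - 1) + (alpha%:R - d%:R + 1) * beta%:R)) :> R.
    rewrite -{1}(ger0_norm (_ : 0 <= alpha%:R - 1 :> R)) ?subr_ge0 //.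
    rewrite -sqrtr_sqr ler_wsqrtr // expr2 -mulrA ler_wpM2l ?subr_ge0 //.
    have p0 : 0 <= (alpha%:R - d%:R + 1) * beta%:R :> R by apply: mulr_ge0 => //; lra.
    by move: p0; set p := _ * beta%:R => p0; nra.
  have : (v%:R : R) <= (2 * alpha + beta * (alpha + 1 - d))%:R by rewrite ler_nat.
  rewrite natrD !natrM natrB ?natrD; last by rewrite (leq_trans ad) // leq_addr.
  by move: sq; set s := Num.sqrt _ => sq; nra.
split; split=> //.
- by move: part1; rewrite aE dE; nia.
- by move=> _; move: part1; rewrite aE dE; nia.
- by move: part1; rewrite aE dE; nia.
- by move=> /simp ade d3; move: part1; rewrite ade dE; nia.
- by split=> [sP|[/simp]] //; split; [apply/simp|apply: simpb].
move=> sP; move: bound2; rewrite (simpb sP) (simp.1 sP).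
rewrite subrr add0r mul1r; congr (_ <= _ + 2 * Num.sqrt _); ring.
Qed.
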